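(* With the cost function $\mathfrak{c}$ defined in the context, the following hold. (1) Among all extractions of a syntactic object from a component $T$ (either an accessible term $T_v\subset T$ or the entire component $T$), the minimal cost is attained by a single leaf $\alpha$, with $\mathfrak{c}(\alpha)=1/\ell(T)$, and the maximal cost is $1$, attained only by selecting the entire component $T$. (2) External Merge and Internal Merge have zero cost: $$\mathfrak{c}(\mathfrak{M}(T,T'))=2-\mathfrak{c}(T)-\mathfrak{c}(T')=0\ \ (\mathrm{EM}),\qquad \mathfrak{c}(\mathfrak{M}(T_v,T/T_v))=1-\mathfrak{c}(T_v)-\mathfrak{c}(T/T_v)=0\ \ (\mathrm{IM}),$$ and they are the only zero-cost operations among External Merge, Internal Merge and the three forms of Sideward Merge. (3) The three forms of Sideward Merge have costs $$\mathrm{SM}(1):\ \mathfrak{c}(\mathfrak{M}(T_v,T'))=1-\mathfrak{c}(T_v)>0,$$ $$\mathrm{SM}(2):\ \mathfrak{c}(\mathfrak{M}(T_v,T'_w))=2-\mathfrak{c}(T_v)-\mathfrak{c}(T'_w)>0,$$ $$\mathrm{SM}(3):\ \mathfrak{c}(\mathfrak{M}(T_v,T_w))=1-\mathfrak{c}(T_v)-\mathfrak{c}(T_w)>0,$$ where in the case $\mathrm{SM}(3)$ the disjoint accessible terms $T_v,T_w\subset T$ satisfy $\ell(T_v)+\ell(T_w)<\ell(T)$. (4) Over the accessible terms $T_v$ of $T=\mathfrak{M}(T_1,T_2)$, the cost $\mathfrak{c}(T_v)$ is smallest for a leaf, with value $1/\ell(T)$, and its maximum is $\max_v\mathfrak{c}(T_v)=\max\{\mathfrak{c}(T_1),\mathfrak{c}(T_2)\}$.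 (5) For each form of Sideward Merge (with the components from which material is extracted fixed), the cost of the operation is maximal when the extracted accessible terms are single leaves.
   Context: Syntactic objects are finite non-planar full binary rooted trees with labelled leaves; $\ell(T)$ is the number of leaves of $T$. A workspace is a finite forest of syntactic objects (its components). For a non-root vertex $v$ of $T$, the accessible term $T_v\subset T$ is the subtree of $v$ and all its descendants. $\mathfrak{M}(A,B)$ is the tree whose root has the two subtrees $A,B$. $T/T_v$ is the quotient of $T$ that removes $T_v$ (deletes it and contracts the resulting non-branching vertex). Costs: the cost of extraction of $T_v\subset T$ is $\mathfrak{c}(T_v):=\ell(T_v)/\ell(T)$ (and selecting a whole component $T$ has cost $\mathfrak{c}(T)=\ell(T)/\ell(T)=1$); the cost of the quotient is $\mathfrak{c}(T/T_v):=1-\ell(T_v)/\ell(T)$; the cost of a Merge operation is $\mathfrak{c}(\mathfrak{M}(A,B)):=\mathfrak{b}(A,B)-\mathfrak{c}(A)-\mathfrak{c}(B)$, where $\mathfrak{b}(A,B)=1$ if $A$ and $B$ both come from the same component of the workspace and $\mathfrak{b}(A,B)=2$ if they come from different components. Operations on a workspace with components including $T,T'$: External Merge (EM) replaces $T\sqcup T'$ by $\mathfrak{M}(T,T')$; Internal Merge (IM) replaces $T$ by $\mathfrak{M}(T_v,T/T_v)$ for an accessible term $T_v\subset T$. Sideward Merge: SM(1) replaces $T\sqcup T'$ by $\mathfrak{M}(T_v,T')\sqcup T/T_v$, with $T_v\subset T$ accessible; SM(2) replaces $T\sqcup T'$ by $\mathfrak{M}(T_v,T'_w)\sqcup T/T_v\sqcup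 T'/T'_w$ with $T_v\subset T$, $T'_w\subset T'$ accessible; SM(3) replaces $T$ by $\mathfrak{M}(T_v,T_w)\sqcup T/(T_v\sqcup T_w)$ with $T_v,T_w\subset T$ disjoint accessible terms, here with $\ell(T_v)+\ell(T_w)<\ell(T)$. *)

(* Defs.v *)
From HB Require Import structures.
From mathcomp Require Import all_boot all_order all_algebra.
Set Implicit Arguments.
Unset Strict Implicit.
Unset Printing Implicit Defensive.
Import Order.TTheory GRing.Theory Num.Theory.
Local Open Scope ring_scope.
Local Open Scope quotient_scope.

Inductive ptree (L : Type) : Type :=
| PLeaf of L
| PNode of ptree L & ptree L.

Fixpoint ptree_encode L (t : ptree L) : GenTree.tree L :=
  match t with
  | PLeaf a => GenTree.Leaf a
  | PNode l r => GenTree.Node 0 [:: ptree_encode l; ptree_encode r]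
  end.

Fixpoint ptree_decode L (t : GenTree.tree L) : option (ptree L) :=
  match t with
  | GenTree.Leaf a => Some (PLeaf a)
  | GenTree.Node _ [:: l; r] =>
      if ptree_decode l is Some l' then
        if ptree_decode r is Some r' then Some (PNode l' r') else None
      else None
  | _ => None
  end.

Lemma ptree_encodeK L : pcancel (@ptree_encode L) (@ptree_decode L).
Proof. by elim=> //= l -> r ->. Qed.

HB.instance Definition _ (L : choiceType) :=
  Choice.copy (ptree L) (pcan_type (@ptree_encodeK L)).

(* Two planar trees are identified when they differ by exchanging the two
   children at any number of nodes. *)
Fixpoint npeq (L : eqType) (s t : ptree L) : bool :=
  match s, t with
  | PLeaf a, PLeaf b => a == b
  | PNode l r, PNode l' r' =>
      (npeq l l' && npeq r r') || (npeq l r' && npeq r l')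
  | _, _ => false
  end.

Lemma npeq_refl (L : eqType) : reflexive (@npeq L).
Proof. by elim=> [a|l IHl r IHr] /=; rewrite ?eqxx // IHl IHr. Qed.

Lemma npeq_sym (L : eqType) : symmetric (@npeq L).
Proof.
elim=> [a|l IHl r IHr] [b|l' r'] //=.
by rewrite !IHl !IHr [npeq r' l && _]andbC.
Qed.

Lemma npeq_trans (L : eqType) : transitive (@npeq L).
Proof.
move=> y x; elim: x y => [a|l IHl r IHr] [b|l' r'] [c|l'' r''] //=.
  by move=> /eqP ->.
case/orP=> /andP [p1 p2] /orP [] /andP [q1 q2]; apply/orP.
- by left; rewrite (IHl _ _ p1 q1) (IHr _ _ p2 q2).
- by right; rewrite (IHl _ _ p1 q1) (IHr _ _ p2 q2).
- by right; rewrite (IHl _ _ p1 q2) (IHr _ _ p2 q1).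
- by left; rewrite (IHl _ _ p1 q2) (IHr _ _ p2 q1).
Qed.

Canonical npeq_equiv (L : choiceType) : equiv_rel (ptree L) :=
  EquivRel (@npeq L) (@npeq_refl L) (@npeq_sym L) (@npeq_trans L).

(* Syntactic objects: non-planar full binary rooted trees. *)
Definition so (L : choiceType) := {eq_quot (npeq_equiv L)}.

Definition so_leaf (L : choiceType) (a : L) : so L := \pi_(so L) (PLeaf a).

Definition so_merge (L : choiceType) (A B : so L) : so L :=
  \pi_(so L) (PNode (repr A) (repr B)).

Definition single_leaf (L : choiceType) (S : so L) : Prop :=
  exists a, S = so_leaf a.

Fixpoint pleaves L (t : ptree L) : nat :=
  match t with
  | PLeaf _ => 1
  | PNode l r => pleaves l + pleaves r
  end.

Definition nleaves (L : choiceType) (T : so L) : nat := pleaves (repr T).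

(* A vertex is addressed by the path leading to it from the root, where [true]
   and [false] select the first and the second child. *)
Fixpoint pvertices L (t : ptree L) : seq (seq bool) :=
  [::] :: match t with
          | PLeaf _ => [::]
          | PNode l r => map (cons true) (pvertices l)
                         ++ map (cons false) (pvertices r)
          end.

(* Only meaningful on vertices of the tree. *)
Fixpoint psubtree L (t : ptree L) (v : seq bool) : ptree L :=
  match v, t with
  | b :: v', PNode l r => psubtree (if b then l else r) v'
  | _, _ => t
  end.

(* Deletes the subtrees at the vertices in [P] and contracts the resulting
   non-branching vertices; [None] is the empty tree. *)
Fixpoint pprune L (P : pred (seq bool)) (t : ptree L) : option (ptree L) :=
  if P [::] then None else
  match t with
  | PLeaf _ => Some t
  | PNode l r =>
      match pprune (fun v => P (true :: v)) l,
            pprune (fun v => P (false :: v)) r with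
      | Some l', Some r' => Some (PNode l' r')
      | Some t', None | None, Some t' => Some t'
      | None, None => None
      end
  end.

(* Accessible terms of [T], given by their non-root vertices. The vertices of
   the non-planar tree are those of its chosen planar representative. *)
Definition acc (L : choiceType) (T : so L) :=
  {v : seq bool | (v \in pvertices (repr T)) && (v != [::])}.

Definition acc_term (L : choiceType) (T : so L) (v : acc T) : so L :=
  \pi_(so L) (psubtree (repr T) (val v)).

Definition disjoint_terms (L : choiceType) (T : so L) (v w : acc T) : bool :=
  ~~ prefix (val v) (val w) && ~~ prefix (val w) (val v).

Definition quot_by (L : choiceType) (T : so L) (s : seq (acc T)) : so L :=
  \pi_(so L) (odflt (repr T) (pprune (mem (map val s)) (repr T))).

(* T / T_v *)
Definition quot (L : choiceType) (T : so L) (v : acc T) : so L :=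
  quot_by [:: v].

(* T / (T_v \sqcup T_w), for disjoint T_v and T_w *)
Definition quot2 (L : choiceType) (T : so L) (v w : acc T) : so L :=
  quot_by [:: v; w].

Lemma pleaves_gt0 L (t : ptree L) : (0 < pleaves t)%N.
Proof. by elim: t => //= l IHl r _; rewrite addn_gt0 IHl. Qed.

Lemma pleaves_psubtree_lt L (t : ptree L) v :
  v \in pvertices t -> v != [::] -> (pleaves (psubtree t v) < pleaves t)%N.
Proof.
elim: t v => [a|l IHl r IHr] [|b v] //=.
rewrite inE /= mem_cat => /orP [] /mapP [u uin [-> ->]] _.
- have: (pleaves (psubtree l u) <= pleaves l)%N.
    by case: u uin => [|c u] uin; [case: (l) | apply/ltnW/IHl].
  by move=> h; rewrite -addn1; apply: leq_add => //; exact: pleaves_gt0.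
- have: (pleaves (psubtree r u) <= pleaves r)%N.
    by case: u uin => [|c u] uin; [case: (r) | apply/ltnW/IHr].
  by move=> h; rewrite -add1n; apply: leq_add => //; exact: pleaves_gt0.
Qed.

Lemma pvertices_uniq L (t : ptree L) : uniq (pvertices t).
Proof.
elim: t => //= l IHl r IHr.
rewrite mem_cat cat_uniq !map_inj_uniq ?IHl ?IHr; try by move=> x y [].
rewrite /= andbT; apply/andP; split.
  by apply/negP=> /orP [] /mapP [].
by apply/hasPn=> _ /mapP [u _ ->]; apply/mapP=> -[].
Qed.

Lemma pprune_None_leq L (t : ptree L) (P : pred (seq bool)) :
  pprune P t = None ->
  (pleaves t <= \sum_(v <- pvertices t | P v) pleaves (psubtree t v))%N.
Proof.
elim: t P => [a|l IHl r IHr] P /=; case: ifP => // P0.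
- by rewrite big_cons P0 leq_addr.
- by rewrite big_cons P0 leq_addr.
case El: (pprune _ l) => [//|]; first by case: (pprune _ r).
case Er: (pprune _ r) => [//|] _.
rewrite big_cons P0 big_cat !big_map /=.
exact: leq_add (IHl _ El) (IHr _ Er).
Qed.

Lemma npeq_pleaves (L : eqType) (s t : ptree L) :
  npeq s t -> pleaves s = pleaves t.
Proof.
elim: s t => [a|l IHl r IHr] [b|l' r'] //=.
by case/orP=> /andP [/IHl -> /IHr ->] //; rewrite addnC.
Qed.

Lemma nleaves_pi (L : choiceType) (t : ptree L) :
  nleaves (\pi_(so L) t) = pleaves t.
Proof. by apply/npeq_pleaves; apply/eqmodP; rewrite reprK. Qed.

Lemma sum_mem_uniq_leq (I : eqType) (s r : seq I) (F : I -> nat) :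
  uniq r -> (\sum_(i <- r | i \in s) F i <= \sum_(i <- s) F i)%N.
Proof.
move=> ur; rewrite -big_filter.
apply: (@sub_le_big_seq _ _ leq leqnn (fun x y => leq_addr y x)).
move=> i; rewrite count_uniq_mem ?filter_uniq // mem_filter -has_pred1 has_count.
by case: (count_mem i s) => //= n; case: (_ \in _).
Qed.

(* The default value in [quot_by] is used neither for a single accessible term
   nor for terms that together have fewer leaves than [T]. *)
Lemma quot_by_nonempty (L : choiceType) (T : so L) (s : seq (acc T)) :
  (\sum_(v <- s) nleaves (acc_term v) < nleaves T)%N ->
  isSome (pprune (mem (map val s)) (repr T)).
Proof.
case E: (pprune _ _) => [//|]; rewrite ltnNge; case/negP.
apply: leq_trans (pprune_None_leq E) _.
apply: leq_trans (sum_mem_uniq_leq _ _ (pvertices_uniq _)) _.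
by rewrite big_map; apply: leq_sum => v _; rewrite nleaves_pi.
Qed.

Lemma nleaves_acc_lt (L : choiceType) (T : so L) (v : acc T) :
  (nleaves (acc_term v) < nleaves T)%N.
Proof.
by have /andP [vin v0] := valP v; rewrite nleaves_pi pleaves_psubtree_lt.
Qed.

(* The ways to extract a syntactic object from the component [T]. *)
Inductive extraction (L : choiceType) (T : so L) : Type :=
| Whole
| Subterm of acc T.
Arguments Whole {L T}.

Definition ext_term (L : choiceType) (T : so L) (e : extraction T) : so L :=
  match e with Whole => T | Subterm v => acc_term v end.

Definition ext_cost (L : choiceType) (T : so L) (e : extraction T) : rat :=
  (nleaves (ext_term e))%:R / (nleaves T)%:R.

Definition acc_cost (L : choiceType) (T : so L) (v : acc T) : rat :=
  ext_cost (Subterm v).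

Definition quot_cost (L : choiceType) (T : so L) (v : acc T) : rat :=
  1 - (nleaves (acc_term v))%:R / (nleaves T)%:R.

(* A forest, its components being indexed by positions so that isomorphic
   components are kept apart; the order of the list is immaterial. *)
Definition workspace (L : choiceType) := seq (so L).

Definition component (L : choiceType) (W : workspace L) (i : 'I_(size W)) : so L :=
  tnth (in_tuple W) i.

(* The arguments of Merge, together with the component they come from. *)
Inductive operand (L : choiceType) (W : workspace L) : Type :=
| Extract (i : 'I_(size W)) of extraction (component i)
| Remainder (i : 'I_(size W)) of acc (component i).

Definition operand_source (L : choiceType) (W : workspace L) (A : operand W) :
  'I_(size W) := match A with Extract i _ => i | Remainder i _ => i end.

Definition operand_term (L : choiceType) (W : workspace L) (A : operand W) :
  so L := match A with Extract _ e => ext_term e | Remainder _ v => quot v end.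

Definition operand_cost (L : choiceType) (W : workspace L) (A : operand W) :
  rat := match A with Extract _ e => ext_cost e | Remainder _ v => quot_cost v end.

Definition bcost (L : choiceType) (W : workspace L) (A B : operand W) : rat :=
  if operand_source A == operand_source B then 1 else 2.

Definition merge_cost (L : choiceType) (W : workspace L) (A B : operand W) :
  rat := bcost A B - operand_cost A - operand_cost B.

Inductive operation (L : choiceType) (W : workspace L) : Type :=
| EM (i j : 'I_(size W)) of i != j
| IM (i : 'I_(size W)) of acc (component i)
| SM1 (i j : 'I_(size W)) of i != j & acc (component i)
| SM2 (i j : 'I_(size W)) of i != j & acc (component i) & acc (component j)
| SM3 (i : 'I_(size W)) (v w : acc (component i)) of disjoint_terms v w
    & (nleaves (acc_term v) + nleaves (acc_term w) < nleaves (component i))%N.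

Definition operands (L : choiceType) (W : workspace L) (o : operation W) :
  operand W * operand W :=
  match o with
  | EM i j _ => (Extract (@Whole _ (component i)), Extract (@Whole _ (component j)))
  | IM i v => (Extract (Subterm v), Remainder v)
  | SM1 i j _ v => (Extract (Subterm v), Extract (@Whole _ (component j)))
  | SM2 i j _ v w => (Extract (Subterm v), Extract (Subterm w))
  | SM3 i v w _ _ => (Extract (Subterm v), Extract (Subterm w))
  end.

Definition op_cost (L : choiceType) (W : workspace L) (o : operation W) : rat :=
  merge_cost (operands o).1 (operands o).2.

Definition remnants (L : choiceType) (W : workspace L) (o : operation W) :
  seq (so L) :=
  match o with
  | EM _ _ _ | IM _ _ => [::]
  | SM1 _ _ _ v => [:: quot v]
  | SM2 _ _ _ v w => [:: quot v; quot w]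
  | SM3 _ v w _ _ => [:: quot2 v w]
  end.

Definition op_result (L : choiceType) (W : workspace L) (o : operation W) :
  workspace L :=
  let: (A, B) := operands o in
  so_merge (operand_term A) (operand_term B) :: remnants o
  ++ [seq component k | k <- enum 'I_(size W) & k \notin [:: operand_source A; operand_source B]].

(* Main.v *)
(* A proper subtree has strictly fewer leaves, so every accessible term costs less
   than 1 and each Sideward Merge is positive. Below every vertex there is a leaf,
   and passing to descendants keeps two terms disjoint, so the bounds at single
   leaves are attained even under the side condition of SM(3). *)
Require Import Defs.
From HB Require Import structures.
From mathcomp Require Import all_boot all_order all_algebra.
From mathcomp Require Import lra.
Set Implicit Arguments.
Unset Strict Implicit.
Unset Printing Implicit Defensive.
Import Order.TTheory GRing.Theory Num.Theory.
Local Open Scope ring_scope.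
Local Open Scope quotient_scope.

(** * Paths and subtrees of planar trees *)

(** Both are initial segments of [s], so the shorter one is an initial segment of the longer. *)
Lemma prefix_comparable (I : eqType) (u v s : seq I) :
  prefix u s -> prefix v s -> prefix u v || prefix v u.
Proof.
rewrite !prefixE => /eqP us /eqP vs.
case/orP: (leq_total (size u) (size v)) => le; apply/orP.
  by left; rewrite -[X in take _ X]vs take_takel ?us.
by right; rewrite -[X in take _ X]us take_takel ?vs.
Qed.

Lemma nil_pvertices K (t : ptree K) : [::] \in pvertices t.
Proof. by case: t => *; rewrite /= mem_head. Qed.

Lemma psubtree_nil K (t : ptree K) : psubtree t [::] = t.
Proof. by case: t. Qed.

Lemma mem_cons_pvertices K (l r : ptree K) b v :
  (b :: v \in pvertices (PNode l r)) = (v \in pvertices (if b then l else r)).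
Proof.
have inj c : injective (cons c : seq bool -> _) by move=> x y [].
rewrite inE /= mem_cat; case: b; rewrite (mem_map (inj _)) ?orbF //.
  (* The other half of the list holds only paths that start with the opposite boolean. *)
  by rewrite orbC; case: mapP => // -[].
by case: mapP => // -[].
Qed.

Lemma psubtree_cat K (t : ptree K) u v :
  u \in pvertices t -> psubtree t (u ++ v) = psubtree (psubtree t u) v.
Proof.
elim: u t => [|b u IHu] [a|l r] //=.
by rewrite mem_cons_pvertices => /IHu.
Qed.

Lemma cat_pvertices K (t : ptree K) u v :
  u \in pvertices t -> v \in pvertices (psubtree t u) -> u ++ v \in pvertices t.
Proof.
elim: u t => [|b u IHu] [a|l r] //=.
by rewrite !mem_cons_pvertices; apply: IHu.
Qed.

(** Descending always to the first child ends at a leaf. *)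
Lemma exists_leaf_vertex K (t : ptree K) :
  exists2 v, v \in pvertices t & exists a, psubtree t v = PLeaf a.
Proof.
elim: t => [a|l [v vl leafv] r _]; first by exists [::] => //; exists a.
by exists (true :: v); rewrite ?mem_cons_pvertices.
Qed.

Lemma pleaves_psubtree_le K (t : ptree K) v :
  v \in pvertices t -> (pleaves (psubtree t v) <= pleaves t)%N.
Proof.
case: v => [|b v] vt; first by rewrite psubtree_nil.
exact/ltnW/pleaves_psubtree_lt.
Qed.

(** * Accessible terms, their leaves and the cost of extraction *)

Section Leaves.
Variable L : choiceType.
Implicit Types T : so L.

Definition mk_acc T v (vT : v \in pvertices (repr T)) (v0 : v != [::]) : acc T :=
  exist _ v (introT andP (conj vT v0)).

Lemma nleaves_gt0 T : (0 < nleaves T)%N.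
Proof. exact: pleaves_gt0. Qed.

Lemma nleaves_single_leaf T : single_leaf T -> nleaves T = 1%N.
Proof. by case=> a ->; rewrite nleaves_pi. Qed.

(** The path to a leaf inside the subtree at [v] is appended to [v]; the result is again a non-root
    vertex because [v] is one. The prefix relation is kept so that disjointness can be passed
    down. *)
Lemma exists_leaf_below T (v : acc T) :
  exists2 w : acc T, single_leaf (acc_term w) & prefix (val v) (val w).
Proof.
case/andP: (valP v) => vT v0.
have [p pv [a leafp]] := exists_leaf_vertex (psubtree (repr T) (val v)).
have vpT := cat_pvertices vT pv.
have vp0 : val v ++ p != [::] by case: (val v) v0.
exists (mk_acc vpT vp0); last exact: prefix_prefix.
by exists a; rewrite /acc_term /= psubtree_cat // leafp.
Qed.

Lemma exists_leaf_extraction T :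
  exists e : extraction T, single_leaf (ext_term e).
Proof.
have [v vT [a leafv]] := exists_leaf_vertex (repr T).
(* If the leaf sits at the root, then [T] is a single leaf and has to be extracted as a whole
   component. *)
have [v0|v0] := eqVneq v [::].
  by exists Whole, a; rewrite /= /so_leaf -leafv v0 psubtree_nil reprK.
by exists (Subterm (mk_acc vT v0)), a; rewrite /= /acc_term /= leafv.
Qed.

(** If [v'] and [w'] were nested, then [v] and [w] would both be prefixes of the longer path, hence
    nested themselves. *)
Lemma disjoint_terms_below T (v w v' w' : acc T) :
  prefix (val v) (val v') -> prefix (val w) (val w') ->
  disjoint_terms v w -> disjoint_terms v' w'.
Proof.
rewrite /disjoint_terms -!negb_or => vv' ww'; apply: contra => /orP [] le.
  exact: prefix_comparable (prefix_trans vv' le) ww'.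
exact: prefix_comparable vv' (prefix_trans ww' le).
Qed.

Lemma ext_cost_Whole T : ext_cost (@Whole L T) = 1.
Proof. by rewrite /ext_cost divff // pnatr_eq0 -lt0n nleaves_gt0. Qed.

Lemma acc_cost_lt1 T (v : acc T) : acc_cost v < 1.
Proof.
by rewrite /acc_cost /ext_cost ltr_pdivrMr ?ltr0n ?nleaves_gt0 // mul1r ltr_nat
  nleaves_acc_lt.
Qed.

(** This is the side condition of SM(3) divided by the number of leaves of [T]. *)
Lemma acc_costD_lt1 T (v w : acc T) :
  (nleaves (acc_term v) + nleaves (acc_term w) < nleaves T)%N ->
  acc_cost v + acc_cost w < 1.
Proof.
move=> lt_vw.
by rewrite /acc_cost /ext_cost -mulrDl ltr_pdivrMr ?ltr0n ?nleaves_gt0 // mul1r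
  -natrD ltr_nat.
Qed.

Lemma ext_cost_leaf T (e : extraction T) :
  single_leaf (ext_term e) -> ext_cost e = 1 / (nleaves T)%:R.
Proof. by rewrite /ext_cost => /nleaves_single_leaf ->. Qed.

Lemma le_ext_cost T (e e' : extraction T) :
  (nleaves (ext_term e) <= nleaves (ext_term e'))%N -> ext_cost e <= ext_cost e'.
Proof. by move=> le; rewrite ler_wpM2r ?invr_ge0 ?ler0n // ler_nat. Qed.

(** All extractions from [T] share the denominator, and every numerator is at least 1. *)
Lemma ext_cost_leaf_le T (e e' : extraction T) :
  single_leaf (ext_term e) -> ext_cost e <= ext_cost e'.
Proof.
by move/nleaves_single_leaf=> e1; apply: le_ext_cost; rewrite e1 nleaves_gt0.
Qed.

Lemma acc_cost_leaf_le T (v v' : acc T) :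
  single_leaf (acc_term v) -> acc_cost v <= acc_cost v'.
Proof. exact: (@ext_cost_leaf_le T (Subterm v) (Subterm v')). Qed.

(* The representative of [so_merge T1 T2] may carry [T1] and [T2] in either
   order, so the child holding [T1] is addressed by some [b]. *)
Lemma so_merge_children T1 T2 :
  exists b, exists v1 v2 : acc (so_merge T1 T2),
    [/\ val v1 = [:: b], val v2 = [:: ~~ b], acc_term v1 = T1 & acc_term v2 = T2].
Proof.
set T := so_merge T1 T2.
(* The chosen representative is only known up to [npeq], which still forces it to be a node. *)
have [l [r [E lr]]] : exists l r,
    repr T = PNode l r /\ npeq (PNode l r) (PNode (repr T1) (repr T2)).
  have: npeq (repr T) (PNode (repr T1) (repr T2)) by apply/eqmodP; rewrite reprK.
  by case: (repr T) => [//|l r]; exists l, r.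
have childP b : [:: b] \in pvertices (repr T).
  by rewrite E mem_cons_pvertices nil_pvertices.
pose child b : acc T := mk_acc (childP b) isT.
have childE b : acc_term (child b) = \pi_(so L) (if b then l else r).
  by rewrite /acc_term [val _]/= E /= psubtree_nil.
have piE t S : npeq t (repr S) -> \pi_(so L) t = S.
  by move=> tS; rewrite -[RHS]reprK; apply/eqmodP.
(* The two alternatives of [npeq] at a node, children in order or exchanged, determine [b]. *)
case/orP: lr => /andP [lE rE].
  by exists true, (child true), (child false); rewrite !childE; split=> //;
    apply: piE.
by exists false, (child false), (child true); rewrite !childE; split=> //;
    apply: piE.
Qed.

(** A non-root vertex lies at or below one of the two children of the root, and leaf counts do not
    grow on passing to a subtree. *)
Lemma acc_cost_le_child T (b : bool) (v1 v2 v : acc T) :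
  val v1 = [:: b] -> val v2 = [:: ~~ b] ->
  acc_cost v <= Num.max (acc_cost v1) (acc_cost v2).
Proof.
move=> v1E v2E; rewrite le_max.
suff: (nleaves (acc_term v) <= nleaves (acc_term v1))%N
   || (nleaves (acc_term v) <= nleaves (acc_term v2))%N.
  by case/orP=> le; apply/orP; [left | right]; apply: le_ext_cost.
rewrite !nleaves_pi; move: v1E v2E (valP v) => -> ->; move: (val v) => {v}v.
(* The first step [c] of the path tells which child is above the vertex. *)
case: (repr T) v => [a|l r] [|c u] //=; rewrite andbT.
rewrite mem_cons_pvertices => /pleaves_psubtree_le.
by case: c; case: b; rewrite /= !psubtree_nil => -> //; rewrite orbT.
Qed.

End Leaves.

(** * Costs of the Merge operations *)

Section Costs.
Variables (L : choiceType) (W : workspace L).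
Implicit Types i j : 'I_(size W).

Lemma op_cost_EM i j (ij : i != j) :
  op_cost (EM ij) = 2 - ext_cost (@Whole L (component i))
                      - ext_cost (@Whole L (component j)).
Proof. by rewrite /op_cost /merge_cost /bcost /= (negbTE ij). Qed.

Lemma op_cost_IM i (v : acc (component i)) :
  op_cost (IM v) = 1 - acc_cost v - quot_cost v.
Proof. by rewrite /op_cost /merge_cost /bcost /= eqxx. Qed.

(** Two components are involved, so the constant is 2; the whole component [j] costs 1, which leaves
    1. *)
Lemma op_cost_SM1 i j (ij : i != j) (v : acc (component i)) :
  op_cost (SM1 ij v) = 1 - acc_cost v.
Proof.
rewrite /op_cost /merge_cost /bcost /= (negbTE ij) ext_cost_Whole.
by rewrite -/(acc_cost v); lra.
Qed.

Lemma op_cost_SM2 i j (ij : i != j) (v : acc (component i))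
    (w : acc (component j)) :
  op_cost (SM2 ij v w) = 2 - acc_cost v - acc_cost w.
Proof. by rewrite /op_cost /merge_cost /bcost /= (negbTE ij). Qed.

Lemma op_cost_SM3 i (v w : acc (component i)) (vw : disjoint_terms v w)
    (lt_vw : (nleaves (acc_term v) + nleaves (acc_term w)
              < nleaves (component i))%N) :
  op_cost (SM3 vw lt_vw) = 1 - acc_cost v - acc_cost w.
Proof. by rewrite /op_cost /merge_cost /bcost /= eqxx. Qed.

Lemma op_cost_SM1_gt0 i j (ij : i != j) (v : acc (component i)) :
  0 < op_cost (SM1 ij v).
Proof. by rewrite op_cost_SM1 subr_gt0 acc_cost_lt1. Qed.

Lemma op_cost_SM2_gt0 i j (ij : i != j) (v : acc (component i))
    (w : acc (component j)) :
  0 < op_cost (SM2 ij v w).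
Proof. by rewrite op_cost_SM2; move: (acc_cost_lt1 v) (acc_cost_lt1 w); lra. Qed.

Lemma op_cost_SM3_gt0 i (v w : acc (component i)) (vw : disjoint_terms v w)
    (lt_vw : (nleaves (acc_term v) + nleaves (acc_term w)
              < nleaves (component i))%N) :
  0 < op_cost (SM3 vw lt_vw).
Proof. by rewrite op_cost_SM3; move: (acc_costD_lt1 lt_vw); lra. Qed.

End Costs.

Theorem proposition7p2 (L : choiceType) :
  (* (1) *)
  (forall T : so L,
     [/\ exists e : extraction T, single_leaf (ext_term e),
         forall e : extraction T, single_leaf (ext_term e) ->
           ext_cost e = 1 / (nleaves T)%:R
           /\ forall e' : extraction T, ext_cost e <= ext_cost e',
         ext_cost (@Whole L T) = 1,
         forall e : extraction T, ext_cost e <= 1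
       & forall e : extraction T, ext_cost e = 1 -> e = Whole])
  /\
  (* (2) *)
  (forall W : workspace L,
     [/\ forall (i j : 'I_(size W)) (ij : i != j),
           op_cost (EM ij) = 2 - ext_cost (@Whole L (component i))
                               - ext_cost (@Whole L (component j))
           /\ op_cost (EM ij) = 0,
         forall (i : 'I_(size W)) (v : acc (component i)),
           op_cost (IM v) = 1 - acc_cost v - quot_cost v
           /\ op_cost (IM v) = 0
       & forall o : operation W, op_cost o = 0 ->
           (exists (i j : 'I_(size W)) (ij : i != j), o = EM ij)
           \/ (exists (i : 'I_(size W)) (v : acc (component i)), o = IM v)])
  /\
  (* (3) *)
  (forall W : workspace L,
     [/\ forall (i j : 'I_(size W)) (ij : i != j) (v : acc (component i)),
           op_cost (SM1 ij v) = 1 - acc_cost v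
           /\ 0 < op_cost (SM1 ij v),
         forall (i j : 'I_(size W)) (ij : i != j)
                (v : acc (component i)) (w : acc (component j)),
           op_cost (SM2 ij v w) = 2 - acc_cost v - acc_cost w
           /\ 0 < op_cost (SM2 ij v w)
       & forall (i : 'I_(size W)) (v w : acc (component i))
                (vw : disjoint_terms v w)
                (lt_vw : (nleaves (acc_term v) + nleaves (acc_term w)
                          < nleaves (component i))%N),
           op_cost (SM3 vw lt_vw) = 1 - acc_cost v - acc_cost w
           /\ 0 < op_cost (SM3 vw lt_vw)])
  /\
  (* (4) *)
  (forall T1 T2 : so L, let T := so_merge T1 T2 in
     [/\ exists v : acc T, single_leaf (acc_term v),
         forall v : acc T, single_leaf (acc_term v) ->
           acc_cost v = 1 / (nleaves T)%:R
           /\ forall v' : acc T, acc_cost v <= acc_cost v'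
       & exists v1 v2 : acc T,
           [/\ [/\ size (val v1) = 1%N, size (val v2) = 1%N & v1 != v2],
               acc_term v1 = T1,
               acc_term v2 = T2,
               forall v : acc T,
                 acc_cost v <= Num.max (acc_cost v1) (acc_cost v2)
             & exists v : acc T,
                 acc_cost v = Num.max (acc_cost v1) (acc_cost v2)]])
  /\
  (* (5) *)
  (forall W : workspace L,
     [/\ forall (i j : 'I_(size W)) (ij : i != j) (v' : acc (component i)),
           (exists v : acc (component i), single_leaf (acc_term v))
           /\ (forall v : acc (component i), single_leaf (acc_term v) ->
                 op_cost (SM1 ij v') <= op_cost (SM1 ij v)),
         forall (i j : 'I_(size W)) (ij : i != j)
                (v' : acc (component i)) (w' : acc (component j)),
           (exists (v : acc (component i)) (w : acc (component j)),
              single_leaf (acc_term v) /\ single_leaf (acc_term w))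
           /\ (forall (v : acc (component i)) (w : acc (component j)),
                 single_leaf (acc_term v) -> single_leaf (acc_term w) ->
                 op_cost (SM2 ij v' w') <= op_cost (SM2 ij v w))
       & forall (i : 'I_(size W)) (v' w' : acc (component i))
                (vw' : disjoint_terms v' w')
                (lt_vw' : (nleaves (acc_term v') + nleaves (acc_term w')
                           < nleaves (component i))%N),
           (exists v w : acc (component i),
              [/\ single_leaf (acc_term v), single_leaf (acc_term w),
                  disjoint_terms v w
                & (nleaves (acc_term v) + nleaves (acc_term w)
                   < nleaves (component i))%N])
           /\ (forall (v w : acc (component i)) (vw : disjoint_terms v w)
                      (lt_vw : (nleaves (acc_term v) + nleaves (acc_term w)
                                < nleaves (component i))%N),
                 single_leaf (acc_term v) -> single_leaf (acc_term w) ->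
                 op_cost (SM3 vw' lt_vw') <= op_cost (SM3 vw lt_vw))]).
Proof.
split=> [T|].
  split; [exact: exists_leaf_extraction | | exact: ext_cost_Whole | |].
  - by move=> e leafe; split=> [|e']; [apply: ext_cost_leaf | apply: ext_cost_leaf_le].
  - by case=> [|v]; [rewrite ext_cost_Whole | apply/ltW/acc_cost_lt1].
  - by case=> [//|v] ve; have := acc_cost_lt1 v; rewrite /acc_cost ve ltxx.
split=> [W|].
  split=> [i j ij|i v|].
  - by split; rewrite op_cost_EM // !ext_cost_Whole; lra.
  (* The costs of a term and of its quotient add up to 1. *)
  - split; rewrite op_cost_IM // /quot_cost /acc_cost /ext_cost /=; lra.
  (* The Sideward cases contradict strict positivity. *)
  - case=> [i j ij|i v|i j ij v|i j ij v w|i v w vw lt_vw] c0.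
    + by left; exists i, j, ij.
    + by right; exists i, v.
    + by have := op_cost_SM1_gt0 ij v; rewrite c0 ltxx.
    + by have := op_cost_SM2_gt0 ij v w; rewrite c0 ltxx.
    + by have := op_cost_SM3_gt0 vw lt_vw; rewrite c0 ltxx.
split=> [W|].
  split=> [i j ij v|i j ij v w|i v w vw lt_vw].
  - by split; [apply: op_cost_SM1 | apply: op_cost_SM1_gt0].
  - by split; [apply: op_cost_SM2 | apply: op_cost_SM2_gt0].
  - by split; [apply: op_cost_SM3 | apply: op_cost_SM3_gt0].
split=> [T1 T2 T|W].
  have [b [v1 [v2 [v1E v2E T1E T2E]]]] := so_merge_children T1 T2.
  split.
  (* Starting below a child of the root guarantees that the leaf is an accessible term, not all of
     [T]. *)
  - by have [v leafv _] := exists_leaf_below v1; exists v.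
  - move=> v leafv; split=> [|v']; last exact: acc_cost_leaf_le.
    exact: (@ext_cost_leaf _ _ (Subterm v)).
  exists v1, v2; split=> // [|v|].
  - by rewrite v1E v2E -val_eqE v1E v2E; case: (b).
  - exact: acc_cost_le_child v1E v2E.
  (* The maximum is attained at the costlier of the two children. *)
  - by have [le|le] := leP (acc_cost v1) (acc_cost v2); [exists v2 | exists v1].
split=> [i j ij v'|i j ij v' w'|i v' w' vw' lt_vw'].
- split=> [|v leafv].
    by have [v leafv _] := exists_leaf_below v'; exists v.
  (* Extraction costs enter with a negative sign, so the cheapest extraction gives the costliest
     operation. *)
  by rewrite !op_cost_SM1; have := acc_cost_leaf_le v' leafv; lra.
- split=> [|v w leafv leafw].
    have [v leafv _] := exists_leaf_below v'.
    by have [w leafw _] := exists_leaf_below w'; exists v, w.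
  rewrite !op_cost_SM2.
  by move: (acc_cost_leaf_le v' leafv) (acc_cost_leaf_le w' leafw); lra.
- split=> [|v w vw lt_vw leafv leafw].
    (* Leaves chosen below the given terms [v'] and [w'] inherit their disjointness. *)
    have [v leafv v'v] := exists_leaf_below v'.
    have [w leafw w'w] := exists_leaf_below w'.
    exists v, w; split=> //; first exact: disjoint_terms_below v'v w'w vw'.
    (* Each given term has at least one leaf, so two single leaves have no more leaves in total than
       [v'] and [w']. *)
    apply: leq_ltn_trans lt_vw'.
    by rewrite (nleaves_single_leaf leafv) (nleaves_single_leaf leafw)
      (@leq_add 1 1) ?nleaves_gt0.
  rewrite !op_cost_SM3.
  by move: (acc_cost_leaf_le v' leafv) (acc_cost_leaf_le w' leafw); lra.
Qed.
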